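(* Let $E^1_\bullet,\dots,E^d_\bullet$ be generally chosen flags in $\mathcal{F}\ell_n$. Let $w^1,\dots,w^d\in S_n$ be permutations such that $\sum_i\ell(w^i)=\dim(\mathcal{F}\ell_n)=\binom n2$. Let $F_\bullet$ be a flag such that $\mathrm{pos}(E^i_\bullet,F_\bullet)=w^i$ for each $1\le i\le d$. Then the rank table of intersection dimensions among the components of the $d+1$ flags is determined by the recurrence $$\dim\left(E^{s_1}_{x_{s_1}}\cap E^{s_2}_{x_{s_2}}\cap\cdots\cap E^{s_k}_{x_{s_k}}\cap F_j\right)=\max\begin{cases}\dim\left(E^{s_1}_{x_{s_1}}\cap F_j\right)+\dim\left(E^{s_2}_{x_{s_2}}\cap\cdots\cap E^{s_k}_{x_{s_k}}\cap F_j\right)-j\\[4pt]\dim\left(E^{s_1}_{x_{s_1}}\cap E^{s_2}_{x_{s_2}}\cap\cdots\cap E^{s_k}_{x_{s_k}}\cap F_{j-1}\right)\end{cases}$$ for all $1\le j\le n$, $k\ge2$, $1\le s_1<s_2<\cdots<s_k\le d$, and $1\le x_{s_i}\le n-1$ for each $1\le i\le k$, where $\dim(F_0)=0$ and $\dim(E^a_i\cap F_j)$ is determined by the rank table corresponding to the permutation $w^a$.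
   Context: Work over an arbitrary field $K$. $\mathcal{F}\ell_n$ is the variety of complete flags $F_\bullet=\{0=F_0\subset F_1\subset\cdots\subset F_n=K^n\}$, $\dim F_i=i$. ''Generally chosen'' means that the statement holds for all $(E^1_\bullet,\dots,E^d_\bullet)$ in a suitable dense Zariski-open subset of $\mathcal{F}\ell_n^d$. To $w\in S_n$ associate the $n\times n$ matrix with a $1$ in row $w(i)$ of column $n-i+1$ for $1\le i\le n$ and $0$ elsewhere (a nonstandard labelling); $w[i,j]$ is its upper-left submatrix formed by rows $1,\dots,i$ and columns $1,\dots,j$. $\ell(w)$ is the number of inversions of $w$. Flags $F_\bullet,G_\bullet$ are in relative position $w$, written $\mathrm{pos}(F_\bullet,G_\bullet)=w$, if $\dim(F_i\cap G_j)=\mathrm{rank}\,w[i,j]$ for all $1\le i,j\le n$. So in the statement $\dim(E^a_i\cap F_j)=\mathrm{rank}\,w^a[i,j]$. *)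

(* Defs.v *)
From HB Require Import structures.
From mathcomp Require Import all_boot all_order all_algebra all_fingroup.
From mathcomp Require Import mpoly.

Set Implicit Arguments.
Unset Strict Implicit.
Unset Printing Implicit Defensive.

Import GRing.Theory.
Local Open Scope nat_scope.

(* The conditions F_0 = 0, F_n = K^n and the strictness of the inclusions all
   follow from flag_dim. *)
Record flag (K : fieldType) (n : nat) := Flag {
  flag_space :> 'I_n.+1 -> {vspace 'rV[K]_n};
  flag_dim : forall i : 'I_n.+1, \dim (flag_space i) = i;
  flag_sub : forall i j : 'I_n.+1,
    i <= j -> (flag_space i <= flag_space j)%VS }.

Definition perm_length (n : nat) (w : 'S_n) : nat :=
  #|[set p : 'I_n * 'I_n | (p.1 < p.2) && (w p.2 < w p.1)]|.

(* With 1-based indices, row w(i) of column n - i + 1 holds the 1 attached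
   to i; [rev_ord] is i |-> n - i + 1.  Thus the identity permutation gives the
   antidiagonal matrix, i.e. two flags in general position. *)
Definition position_mx (K : fieldType) (n : nat) (w : 'S_n) : 'M[K]_n :=
  \matrix_(r, c) ((r == w (rev_ord c))%:R)%R.

Definition position_submx (K : fieldType) (n : nat) (w : 'S_n)
    (i j : 'I_n.+1) : 'M[K]_(i, j) :=
  mxsub (widen_ord (leq_ord i)) (widen_ord (leq_ord j)) (position_mx K w).

Definition relative_position (K : fieldType) (n : nat)
    (E F : flag K n) (w : 'S_n) : Prop :=
  forall i j : 'I_n.+1, 0 < i -> 0 < j ->
    \dim (E i :&: F j)%VS = \rank (position_submx K w i j).

Definition adapted_basis (K : fieldType) (n : nat)
    (M : 'M[K]_n) (E : flag K n) : Prop :=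
  M \in unitmx /\
  forall i : 'I_n.+1, E i = (\sum_(r < n | r < i) <[row r M]>)%VS.

(* A subset of the variety Fl_n^d over K is given by its L-points for every
   field extension iota : K -> L.  The K-points alone would not do: when K is
   finite, a nonempty open subset of Fl_n^d may have no K-point. *)
Definition flags_subset (K : fieldType) (n d : nat) : Type :=
  forall (L : fieldType) (iota : {rmorphism K -> L}),
    ('I_d -> flag L n) -> Prop.

(* One variable for each entry (a, r, c) of a d-tuple of n x n matrices. *)
Definition entry_poly (K : fieldType) (n d : nat) : Type :=
  {mpoly K[#|{: 'I_d * 'I_n * 'I_n}|]}.

Definition entry_eval (K : fieldType) (n d : nat) (L : fieldType)
    (iota : {rmorphism K -> L}) (M : 'I_d -> 'M[L]_n)
    (P : entry_poly K n d) : L :=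
  mmap iota
    (fun v => let t := enum_val v in M t.1.1 t.1.2 t.2) P.

(* Zariski topology on Fl_n^d = (GL_n / B)^d: a subset is open when its
   preimage under (GL_n)^d -> Fl_n^d is open, i.e. is the complement in
   (GL_n)^d of the zero locus of a set I of polynomials over K. *)
Definition zariski_open (K : fieldType) (n d : nat)
    (U : flags_subset K n d) : Prop :=
  exists I : entry_poly K n d -> Prop,
    forall (L : fieldType) (iota : {rmorphism K -> L})
      (M : 'I_d -> 'M[L]_n) (E : 'I_d -> flag L n),
      (forall a, adapted_basis (M a) (E a)) ->
      (U L iota E <-> exists2 P, I P & entry_eval iota M P <> 0%R).

Definition zariski_dense (K : fieldType) (n d : nat)
    (U : flags_subset K n d) : Prop :=
  forall V : flags_subset K n d, zariski_open V ->
    (exists (L : fieldType) (iota : {rmorphism K -> L})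
       (E : 'I_d -> flag L n), V L iota E) ->
    exists (L : fieldType) (iota : {rmorphism K -> L})
       (E : 'I_d -> flag L n), V L iota E /\ U L iota E.

(* Main.v *)
Require Import Defs.
From HB Require Import structures.
From mathcomp Require Import all_boot all_order all_algebra all_fingroup.
From mathcomp Require Import mpoly zify.

(** Write T for the intersection of F_j with all the E^a_(x_a) of the
    recurrence.  Linear algebra gives one inequality; the content is that T
    either lies in F_(j-1) or has the dimension expected of a transverse
    intersection inside F_j, namely j minus the sum of the codimensions of the
    E^a_(x_a) :&: F_j.  In the first case the second term of the maximum is
    attained.  In the second case the first one is, because the intersection
    without E^(s_1) has at least the expected dimension.

    The dichotomy is a count of parameters.  Suppose that T is not contained in
    F_(j-1) and is too large, say of dimension D.  Choose u in T whose
    coordinate at j, in a basis adapted to F, is 1, and which vanishes at D - 1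
    earlier coordinates: such a u depends on j - D parameters
    ([pick_vector], where, as in all the lemmas, columns are numbered from 0).
    Take a basis adapted to F having u as its j-th vector.  By a Bruhat
    decomposition, the bases adapted to a flag E^a in position w^a to F depend
    on n^2 - l(w^a) parameters, and the condition u \in E^a_(x_a) removes
    codim_(F_j)(E^a_(x_a) :&: F_j) of them ([bruhat_through],
    [card_flag_slots]).  Adding the n(n-1)/2 parameters of F, which cancel
    against the sum of the lengths, the d-tuples of bases that admit such an F
    are polynomial in at most
      d n^2 + (j - D) - (sum of the codimensions) < d n^2
    parameters ([excess_patterned]).

    Now d n^2 polynomials in fewer than d n^2 variables are algebraically
    dependent ([algebraic_dependence]), so that the exceptional tuples satisfy
    a nonzero polynomial equation over K.  The flags [generic_flags] where some
    such equation fails form an open set, because the exceptional family is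
    stable under change of adapted basis, and a dense one, because the product
    of the finitely many equations does not vanish at the tuple of generic
    matrices over the field of rational functions. *)

Set Implicit Arguments.
Unset Strict Implicit.
Unset Printing Implicit Defensive.

Import GRing.Theory.
Local Open Scope ring_scope.

(** * Algebraic dependence *)

Lemma msize_mul_le (K : fieldType) N (p q : {mpoly K[N]}) a b :
  (msize p <= a.+1)%N -> (msize q <= b.+1)%N -> (msize (p * q) <= (a + b).+1)%N.
Proof.
have [->|p0] := eqVneq p 0; first by rewrite mul0r msize0.
have [->|q0] := eqVneq q 0; first by rewrite mulr0 msize0.
move=> ha hb; rewrite msizeM // -ltnS prednK; last first.
  by rewrite addn_gt0 lt0n msize_poly_eq0 p0.
by rewrite -addSn -addnS leq_add.
Qed.

Lemma msize_exp_le (K : fieldType) N (p : {mpoly K[N]}) a e :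
  (msize p <= a.+1)%N -> (msize (p ^+ e) <= (e * a).+1)%N.
Proof.
move=> ha; elim: e => [|e IHe]; first by rewrite expr0 msize1.
by rewrite exprS mulSn msize_mul_le.
Qed.

Lemma msize_prod_le (K : fieldType) N m (f : 'I_m -> {mpoly K[N]}) (a : 'I_m -> nat) :
  (forall i, msize (f i) <= (a i).+1)%N ->
  (msize (\prod_i f i) <= (\sum_i a i).+1)%N.
Proof.
move=> ha; apply: (big_ind2 (fun p (s : nat) => msize p <= s.+1)%N) => //.
  by rewrite msize1.
by move=> p a1 q a2; apply: msize_mul_le.
Qed.

Lemma card_bmultinom N b : (#|{: 'X_{1..N < b}}| <= b ^ N)%N.
Proof.
case: b => [|b].
  by rewrite (_ : #|_| = 0)%N //; apply: eq_card0 => -[].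
pose h (x : 'X_{1..N < b.+1}) : {ffun 'I_N -> 'I_b.+1} := [ffun i => inord (x i)].
have h_inj : injective h.
  move=> x y /ffunP hxy; apply/val_inj/mnmP => i; move: (hxy i); rewrite !ffunE.
  have le (z : 'X_{1..N < b.+1}) : (z i <= b)%N.
    by rewrite -ltnS; apply: leq_ltn_trans (valP z); rewrite mdegE (bigD1 i) //= leq_addr.
  by move/(congr1 (@nat_of_ord _)); rewrite !inordK // ltnS le.
by have := leq_card h h_inj; rewrite card_ffun !card_ord.
Qed.

(** The monomials in the f_i with all exponents below k number k ^ m, and they
    lie in a space of polynomials whose dimension grows only like k ^ N; for
    large k they are linearly dependent. *)
Lemma algebraic_dependence (K : fieldType) N m (f : 'I_m -> {mpoly K[N]}) : (N < m)%N ->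
  exists2 P : {mpoly K[m]}, P != 0 & mmap (@mpolyC N K) f P = 0.
Proof.
move=> ltNm.
(* D bounds the degrees, so that the products of powers below k have degree
   below B; c is such that B <= k * c, whence B ^ N <= k ^ N * c ^ N < k ^ N.+1 *)
pose D := \max_i msize (f i).
pose c := (m * D).+1; pose k := (c ^ N).+1; pose B := (m * (k * D)).+1.
pose mon (e : {ffun 'I_m -> 'I_k}) : 'X_{1..m} := [multinom (e i : nat) | i < m].
have mon_inj : injective mon.
  move=> e1 e2 /mnmP he; apply/ffunP=> i; apply/val_inj.
  by have := he i; rewrite !mnmE.
have szmon e : (msize (mmap1 f (mon e)) <= B)%N.
  apply: (@leq_trans (\sum_(i < m) (e i * D)%N).+1).
    rewrite /mmap1; apply: msize_prod_le => i; rewrite mnmE.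
    by apply: msize_exp_le; rewrite leqW // /D (leq_bigmax i).
  rewrite ltnS (@leq_trans (\sum_(i < m) (k * D)))//; last first.
    by rewrite sum_nat_const card_ord.
  by apply: leq_sum => i _; rewrite leq_mul2r (ltnW (ltn_ord _)) orbT.
pose A := \matrix_(r < #|{ffun 'I_m -> 'I_k}|, s < #|{: 'X_{1..N < B}}|)
   ((mmap1 f (mon (enum_val r)))@_(enum_val s : 'X_{1..N < B})).
have ltA : (#|{: 'X_{1..N < B}}| < #|{ffun 'I_m -> 'I_k}|)%N.
  apply: leq_ltn_trans (card_bmultinom _ _) _; rewrite card_ffun !card_ord.
  apply: (@leq_ltn_trans ((k * c) ^ N)).
    have exp_mono a b e : (a <= b)%N -> (a ^ e <= b ^ e)%N.
      by move=> leab; elim: e => // e IHe; rewrite !expnS leq_mul.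
    by apply: exp_mono; rewrite /B /c mulnS mulnCA -add1n leq_add2r.
  by rewrite expnMn (@leq_trans (k ^ N.+1)) ?leq_pexp2l // expnSr ltn_pmul2l ?expn_gt0.
have /rowV0Pn[v /sub_kermxP vA v0] : kermx A != 0.
  rewrite -mxrank_eq0 mxrank_ker subn_eq0 -ltnNge.
  exact: leq_ltn_trans (rank_leq_col _) ltA.
exists (\sum_r v 0 r *: 'X_[mon (enum_val r)]).
  apply: contraNneq v0 => P0; apply/eqP/rowP=> r; rewrite mxE.
  have := congr1 (mcoeff (mon (enum_val r))) P0.
  rewrite mcoeff0 raddf_sum (bigD1 r) //= mcoeffZ mcoeffX eqxx mulr1 big1 ?addr0 //.
  move=> s nsr; rewrite mcoeffZ mcoeffX inj_eq // (inj_eq enum_val_inj).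
  by rewrite (negPf nsr) mulr0.
rewrite raddf_sum /=; apply/mpolyP => e; rewrite mcoeff0 raddf_sum /=.
have [lte|] := ltnP (mdeg e) B; last first.
  move=> leB; apply: big1 => r _; rewrite mmapZ mmapX /= mul_mpolyC mcoeffZ.
  by rewrite [X in _ * X]memN_msupp_eq0 ?mulr0 // msize_mdeg_ge // (leq_trans (szmon _)).
transitivity ((v *m A) 0 (enum_rank (BMultinom lte))); last by rewrite vA mxE.
rewrite mxE; apply: eq_bigr => r _; rewrite mxE enum_rankK.
by rewrite mmapZ mmapX /= mul_mpolyC mcoeffZ.
Qed.

(** * Flags and adapted bases *)

Lemma trig_mul (R : comNzRingType) n (A B : 'M[R]_n) :
  is_trig_mx A -> is_trig_mx B -> is_trig_mx (A *m B).
Proof.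
move=> /is_trig_mxP At /is_trig_mxP Bt; apply/is_trig_mxP => r c rc.
rewrite mxE big1 // => k _; have [rk|kr] := ltnP r k; first by rewrite At ?mul0r.
by rewrite Bt ?mulr0 // (leq_ltn_trans kr).
Qed.

(** As adapted bases are given by the rows of a matrix, the spans of sets of
    rows describe both the members of a flag (initial segments) and the
    subspaces where given coordinates vanish. *)
Definition row_span (L : fieldType) n (G : 'M[L]_n) (S : {set 'I_n}) :
    {vspace 'rV[L]_n} :=
  (\sum_(r in S) <[row r G]>)%VS.

Section RowSpan.
Variables (L : fieldType) (n : nat).
Implicit Types (G : 'M[L]_n) (S : {set 'I_n}) (v : 'rV[L]_n).

Lemma dim_row_vectors : \dim {:'rV[L]_n} = n.
Proof. rewrite dimvf; exact: mul1n. Qed.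

Lemma row_spanP G S v : G \in unitmx ->
  reflect (forall c, c \notin S -> (v *m invmx G) 0 c = 0) (v \in row_span G S).
Proof.
move=> Gu; apply: (iffP idP) => [/memv_sumP[vs vsP ->] c cS|v0].
  rewrite mulmx_suml summxE big1 // => r rS; have /vlineP[k ->] := vsP _ rS.
  rewrite -scalemxAl -row_mul mulmxV // !mxE; case: eqP => [rc|]; last by rewrite mulr0.
  by rewrite rc (negPf cS) in rS.
rewrite -[v](mulmxKV Gu) mulmx_sum_row memv_suml // => r _.
have [rS|rS] := boolP (r \in S); last by rewrite v0 // scale0r mem0v.
apply: memvZ; apply: subvP (memv_line _).
by apply: (sumv_sup r).
Qed.

Lemma dim_row_span G S : G \in unitmx -> \dim (row_span G S) = #|S|.
Proof.
move=> Gu; have le T : (\dim (row_span G T) <= #|T|)%N.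
  apply: (leq_trans (dimv_leq_sum _ _ _)); rewrite -sum1_card leq_sum // => r _.
  by rewrite dim_vline leq_b1.
apply/eqP; rewrite eqn_leq le /=.
have full : (row_span G S + row_span G (~: S) = fullv)%VS.
  apply/eqP; rewrite eqEsubv subvf /=; apply/subvP=> v _.
  rewrite -[v](mulmxKV Gu) mulmx_sum_row (bigID (mem S)) /= memv_add //.
    by apply: memv_sumr => r rS; rewrite memvZ ?memv_line.
  rewrite (eq_bigl (mem (~: S))); last by move=> r; rewrite /= in_setC.
  by apply: memv_sumr => r rS; rewrite memvZ ?memv_line.
have := leq_of_leqif (dimv_add_leqif (row_span G S) (row_span G (~: S))).
rewrite full dim_row_vectors => h.
have := leq_trans h (leq_add (leqnn _) (le (~: S))).
by rewrite -[X in (X <= _)%N]card_ord -(cardsC S) leq_add2r.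
Qed.

(** Membership in the span of the rows outside Z is the vanishing of the
    coordinates in Z, that is, #|Z| linear conditions. *)
Lemma dim_cap_row_span G (W : {vspace 'rV[L]_n}) (Z : {set 'I_n}) : G \in unitmx ->
  (\dim W <= \dim (W :&: row_span G (~: Z)) + #|Z|)%N.
Proof.
move=> Gu; have := dimv_sum_cap W (row_span G (~: Z)); rewrite dim_row_span //.
have := dimvS (subvf (W + row_span G (~: Z))).
rewrite dim_row_vectors; have := cardsC Z; rewrite card_ord; lia.
Qed.

Lemma row_spanS G S (T : {set 'I_n}) : S \subset T -> (row_span G S <= row_span G T)%VS.
Proof. by move=> ST; apply/subv_sumP=> r rS; apply: sumv_sup (subvv _); apply: (subsetP ST). Qed.

Definition initial (i : nat) : {set 'I_n} := [set r : 'I_n | r < i]%N.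

Lemma adaptedE G (E : flag L n) :
  adapted_basis G E -> forall i, E i = row_span G (initial i).
Proof.
by case=> _ h i; rewrite h; apply: eq_bigl => r; rewrite inE.
Qed.

Lemma card_initial (i : 'I_n.+1) : #|initial i| = i.
Proof.
have winj : injective (widen_ord (leq_ord i)) by move=> r s [/val_inj].
rewrite -[RHS]card_ord -(card_imset _ winj).
apply: eq_card => r; rewrite inE; apply/idP/imsetP => [ri|[s _ ->]] //=.
by exists (Ordinal ri) => //; apply/val_inj.
Qed.

Lemma adaptedP G (E : flag L n) :
  G \in unitmx -> (forall r : 'I_n, row r G \in E (lift ord0 r)) -> adapted_basis G E.
Proof.
move=> Gu h; split=> // i; apply/esym/eqP.
rewrite (eq_bigl (mem (initial i))); last by move=> r; rewrite /= inE.
rewrite -[X in X == _]/(row_span G (initial i)).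
rewrite -(geq_leqif (dimv_leqif_eq _)).
  by rewrite flag_dim dim_row_span // card_initial.
apply/subv_sumP => r; rewrite inE => ri.
rewrite -memvE; apply: (subvP (flag_sub E _)) (h r); exact: ri.
Qed.

Lemma row_adapted G (E : flag L n) r : adapted_basis G E -> row r G \in E (lift ord0 r).
Proof.
move=> aG; rewrite (adaptedE aG); apply: subvP (memv_line _).
by apply: sumv_sup (subvv _); rewrite inE.
Qed.

(** Two bases adapted to the same flag differ by an element of the Borel
    subgroup, so that a condition on bases is a condition on flags when it is
    stable under multiplication by lower triangular matrices. *)
Lemma adapted_trig G G' (E : flag L n) :
  adapted_basis G E -> adapted_basis G' E -> is_trig_mx (G' *m invmx G).
Proof.
move=> aG aG'; apply/is_trig_mxP=> r c rc.
have := row_adapted r aG'; rewrite (adaptedE aG).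
move/(row_spanP _ _ aG.1)/(_ c); rewrite inE /= ltnS -ltnNge => /(_ rc).
by rewrite -row_mul !mxE.
Qed.

Lemma flag_of_basis G : G \in unitmx -> exists E : flag L n, adapted_basis G E.
Proof.
move=> Gu.
have hd (i : 'I_n.+1) : \dim (row_span G (initial i)) = i by rewrite dim_row_span // card_initial.
have hs (i j : 'I_n.+1) : (i <= j)%N -> (row_span G (initial i) <= row_span G (initial j))%VS.
  by move=> ij; apply/row_spanS/subsetP=> r; rewrite !inE => /leq_trans; apply.
exists (Flag hd hs); split=> // i /=; apply: eq_bigl => r; by rewrite inE.
Qed.

Lemma trig_inv (B : 'M[L]_n) : B \in unitmx -> is_trig_mx B -> is_trig_mx (invmx B).
Proof.
move=> Bu /is_trig_mxP Bt; apply/is_trig_mxP => r c.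
have Bd s : B s s != 0.
  move: Bu; rewrite unitmxE det_trig; last exact/is_trig_mxP.
  by rewrite unitfE => /prodf_neq0; apply.
have [m] := ubnP r; elim: m => // m IHm in r c *; rewrite ltnS => rm rc.
have := congr1 (fun A : 'M_n => A r c) (mulmxV Bu); rewrite !mxE (bigD1 r) //=.
rewrite big1 ?addr0.
  have [/val_eqP/=|_] := eqVneq r c; first by rewrite (ltn_eqF rc).
  by move/eqP; rewrite mulf_eq0 (negPf (Bd r)) => /eqP.
move=> k kr; have [rk|] := ltnP r k; first by rewrite Bt ?mul0r.
rewrite leq_eqVlt (negPf kr : (k == r :> nat) = false) /= => kr'.
by rewrite IHm ?mulr0 // (leq_trans kr' rm, ltn_trans kr' rc).
Qed.

(** Relative to any basis G' adapted to E, such a G is lower triangular with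
    nonzero diagonal. *)
Lemma staircase_adapted (E : flag L n) (G : 'M[L]_n) (G' : 'M[L]_n) :
  adapted_basis G' E ->
  (forall r : 'I_n, row r G \in E (lift ord0 r)) ->
  (forall r : 'I_n, row r G \notin E (widen_ord (leqnSn n) r)) -> adapted_basis G E.
Proof.
move=> aG' hin hout; apply: adaptedP => //.
pose B := G *m invmx G'.
have Bt : is_trig_mx B.
  apply/is_trig_mxP => r c rc; have := hin r; rewrite (adaptedE aG').
  move/(row_spanP _ _ aG'.1)/(_ c); rewrite inE /= ltnS -ltnNge => /(_ rc).
  by rewrite -row_mul !mxE.
have Bu : B \in unitmx.
  rewrite unitmxE (det_trig Bt) unitfE; apply/prodf_neq0 => r _.
  apply: contraNneq (hout r) => Brr; rewrite (adaptedE aG').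
  apply/(row_spanP _ _ aG'.1) => c; rewrite inE /= -leqNgt -row_mul -/B mxE.
  rewrite leq_eqVlt => /predU1P[/val_inj<-//|rc].
  by move/is_trig_mxP: Bt; apply.
by rewrite -(mulmxKV aG'.1 G) unitmx_mul Bu aG'.1.
Qed.

Lemma flag_full (E : flag L n) : E ord_max = fullv.
Proof. by apply/eqP; rewrite eqEdim subvf flag_dim dim_row_vectors /=. Qed.

Lemma flag_has_basis (E : flag L n) : exists G : 'M[L]_n, adapted_basis G E.
Proof.
have dE i : \dim (E i) = i := flag_dim E i.
pose lo (r : 'I_n) := widen_ord (leqnSn n) r.
have /fin_all_exists[v vP] (r : 'I_n) :
    exists v, v \in E (lift ord0 r) /\ v \notin E (lo r).
  have /subvPn[v] : ~~ (E (lift ord0 r) <= E (lo r))%VS.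
    by apply/negP => /dimvS; rewrite !dE /= /bump /= ltnn.
  by exists v.
pose G := \matrix_r v r; exists G.
have inG (i : 'I_n.+1) : (E i <= row_span G (initial i))%VS.
  case: i => i; elim: i => [|i IHi] ltin.
    by rewrite (_ : E _ = 0%VS) ?sub0v //; apply/eqP; rewrite -dimv_eq0 dE.
  pose r := Ordinal (ltin : (i < n)%N).
  have Elo : E (lo r) = E (Ordinal (ltnW ltin)) by congr (E _); apply/val_inj.
  have Ehi : E (lift ord0 r) = E (Ordinal ltin) by congr (E _); apply/val_inj.
  have [vin vout] := vP r.
  have eE : (E (lo r) + <[v r]>)%VS == E (Ordinal ltin).
    have sE : (E (lo r) + <[v r]> <= E (Ordinal ltin))%VS.
      by rewrite subv_add -memvE -{2}Ehi vin andbT Elo; apply: flag_sub; rewrite /=.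
    rewrite eqEdim sE dE /= ltnNge; apply: contra vout => le.
    rewrite memvE (subv_trans (addvSr (E (lo r)) _)) //.
    by have := dimv_leqif_sup (addvSl (E (lo r)) <[v r]>%VS) => /geq_leqif <-; rewrite dE.
  rewrite -(eqP eE) subv_add Elo (subv_trans (IHi _)) /=; last first.
    by apply/row_spanS/subsetP => s; rewrite !inE => /ltnW.
  rewrite -memvE; have -> : v r = row r G by rewrite rowK.
  by apply: (subvP _ _ (memv_line _)); apply: sumv_sup (subvv _); rewrite inE /=.
apply: adaptedP => [|r]; last by rewrite rowK; have [] := vP r.
rewrite -row_full_unit -sub1mx; apply/row_subP => i.
have : row i (1%:M : 'M[L]_n) \in row_span G (initial n).
  apply: (subvP (inG ord_max)).
  by rewrite flag_full memvf.
move=> /memv_sumP[vs vsP ->]; apply: summx_sub => r ri.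
by have /vlineP[k ->] := vsP r ri; rewrite scalemx_sub // row_sub.
Qed.
End RowSpan.

(** * Tuples of matrices depending on few parameters *)

Section Patterns.
Variables (K : fieldType) (n d : nat).

Local Notation coord := ('I_d * 'I_n * 'I_n)%type.
Local Notation m := #|{: coord}|.

(** On fields this is [entry_eval]; arbitrary commutative rings are allowed
    because relations are found, and transformed, by evaluating at matrices
    with polynomial entries. *)
Definition tuple_eval (R : comNzRingType) (f : {rmorphism K -> R})
    (M : 'I_d -> 'M[R]_n) (P : entry_poly K n d) : R :=
  mmap f (fun v => let t := enum_val v in M t.1.1 t.1.2 t.2) P.

HB.instance Definition _ (R : comNzRingType) (f : {rmorphism K -> R}) M :=
  GRing.RMorphism.copy (tuple_eval f M)
    (mmap f (fun v => let t := enum_val v in M t.1.1 t.1.2 t.2)).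

Lemma tuple_evalC (R : comNzRingType) (f : {rmorphism K -> R}) M x :
  tuple_eval f M x%:MP = f x.
Proof. exact: mmapC. Qed.

Lemma tuple_evalX (R : comNzRingType) (f : {rmorphism K -> R}) M a r c :
  tuple_eval f M 'X_(enum_rank (a, r, c)) = M a r c.
Proof. by rewrite /tuple_eval mmapX mmap1U enum_rankK. Qed.

Lemma tuple_eval_comp (R S : comNzRingType) (f : {rmorphism K -> R})
    (g : {rmorphism R -> S}) (M : 'I_d -> 'M[R]_n) P :
  g (tuple_eval f M P) = tuple_eval (g \o f) (fun a => map_mx g (M a)) P.
Proof.
rewrite /tuple_eval /mmap rmorph_sum; apply: eq_bigr => e _.
rewrite rmorphM /mmap1 rmorph_prod; congr (_ * _); apply: eq_bigr => v _.
by rewrite rmorphXn /= mxE.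
Qed.

Lemma eq_tuple_eval (R : comNzRingType) (f g : {rmorphism K -> R})
    (M N : 'I_d -> 'M[R]_n) P :
  f =1 g -> M =1 N -> tuple_eval f M P = tuple_eval g N P.
Proof.
move=> fg MN; rewrite /tuple_eval /mmap; apply: eq_bigr => e _.
by rewrite fg; congr (_ * _); apply: eq_bigr => v _; rewrite MN.
Qed.

(** The parametrizations are products of matrices in which some entries (the
    slots, the first component of a shape) are free and the others are
    prescribed to be 0 or 1 (the second component).  Each member of a d-tuple
    has three factors of its own, followed by three factors common to all. *)
Definition factor := ('I_d * 'I_3 + 'I_3)%type.
Definition shape := ({set 'I_n * 'I_n} * 'M[bool]_n)%type.
Definition pattern := {ffun factor -> shape}.

Definition fits (R : comNzRingType) (p : shape) (A : 'M[R]_n) :=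
  forall r c, (r, c) \notin p.1 -> A r c = (p.2 r c)%:R.

Definition patterned (R : comNzRingType) (th : pattern) (M : 'I_d -> 'M[R]_n) :=
  exists2 A : factor -> 'M[R]_n, forall i, fits (th i) (A i) &
    forall a, M a = A (inl (a, 0)) *m (A (inl (a, 1)) *m A (inl (a, 2%:R))) *m
                    (A (inr 0) *m (A (inr 1) *m A (inr 2%:R))).

Definition pattern_dim (th : pattern) := (\sum_i #|(th i).1|)%N.

Definition lower_shape : shape := ([set p : 'I_n * 'I_n | p.2 <= p.1]%N, const_mx false).

(** The lower triangular leftmost factors make the set of tuples with a given
    pattern stable under change of adapted bases. *)
Definition deficient (th : pattern) :=
  (pattern_dim th < #|{: coord}|)%N && [forall a, th (inl (a, 0)) == lower_shape].

Lemma fits_lower (R : comNzRingType) (A : 'M[R]_n) :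
  fits lower_shape A <-> is_trig_mx A.
Proof.
split=> [h|/is_trig_mxP h r c]; first apply/is_trig_mxP => r c rc.
  by rewrite h ?inE /= -?ltnNge // mxE.
by rewrite inE /= -ltnNge mxE => /h.
Qed.

Definition slots (th : pattern) : {set factor * ('I_n * 'I_n)} :=
  [set q | q.2 \in (th q.1).1].

Lemma card_slots th : #|slots th| = pattern_dim th.
Proof.
rewrite -sum1_card /pattern_dim.
rewrite (eq_bigr (fun i => \sum_(p in (th i).1) 1)%N); last by move=> i _; rewrite sum1_card.
by rewrite pair_big_dep /=; apply: eq_bigl => q; rewrite inE.
Qed.

(** Tuples with the given pattern are the specializations of a generic one,
    whose d n^2 entries are polynomials in fewer than d n^2 variables. *)
Lemma patterned_relation th : deficient th ->
  exists2 P : entry_poly K n d, P != 0 &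
    forall (R : comNzRingType) (f : {rmorphism K -> R}) (M : 'I_d -> 'M[R]_n),
      patterned th M -> tuple_eval f M P = 0.
Proof.
case/andP=> ltdim _; set N := #|slots th|.
pose A i : 'M[{mpoly K[N]}]_n := \matrix_(r, c)
  if (r, c) \in (th i).1 then \sum_(v < N | enum_val v == (i, (r, c))) 'X_v
  else ((th i).2 r c)%:R.
pose M a := A (inl (a, 0)) *m (A (inl (a, 1)) *m A (inl (a, 2%:R))) *m
                    (A (inr 0) *m (A (inr 1) *m A (inr 2%:R))).
have ltN : (N < #|{: coord}|)%N by rewrite /N card_slots.
have [P P0 PM] := algebraic_dependence (fun v => let t := enum_val v in M t.1.1 t.1.2 t.2) ltN.
exists P => // R f M' [A' fA' MA'].
pose g : {rmorphism {mpoly K[N]} -> R} :=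
  mmap f (fun v : 'I_N => let q := enum_val v in A' q.1 q.2.1 q.2.2).
have gA i : map_mx g (A i) = A' i.
  apply/matrixP => r c; rewrite !mxE; case: ifPn => [inS|/(fA' i)->]; last first.
    by rewrite rmorph_nat.
  have inN : (i, (r, c)) \in slots th by rewrite inE.
  rewrite (big_pred1 (enum_rank_in inN (i, (r, c)))).
    by rewrite /g /= mmapX mmap1U enum_rankK_in.
  move=> v; rewrite /= -(inj_eq enum_val_inj) enum_rankK_in //.
have := congr1 g PM; rewrite rmorph0 => <-.
rewrite -[mmap _ _ P]/(tuple_eval (@mpolyC N K) M P) tuple_eval_comp.
apply: eq_tuple_eval => [x|a]; first by rewrite /g /= mmapC.
by rewrite MA' /M !map_mxM !gA.
Qed.

Definition pattern_ideal (P : entry_poly K n d) : Prop :=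
  forall th, deficient th ->
  forall (R : comNzRingType) (f : {rmorphism K -> R}) (M : 'I_d -> 'M[R]_n),
    patterned th M -> tuple_eval f M P = 0.

(** There are finitely many patterns, hence a product of relations makes
    sense. *)
Lemma pattern_ideal_neq0 : exists2 P, pattern_ideal P & P != 0.
Proof.
have /fin_all_exists[P PP] th : exists P : entry_poly K n d, P != 0 /\ (deficient th ->
    forall (R : comNzRingType) (f : {rmorphism K -> R}) (M : 'I_d -> 'M[R]_n),
      patterned th M -> tuple_eval f M P = 0).
  have [/patterned_relation[P P0 PM]|_] := boolP (deficient th); first by exists P.
  by exists 1; rewrite oner_eq0.
exists (\prod_th P th); last by apply/prodf_neq0 => th _; have [] := PP th.
move=> th sth R f M sM; rewrite /tuple_eval rmorph_prod (bigD1 th) //=.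
by have [_ /(_ sth _ f _ sM)] := PP th; rewrite /tuple_eval => ->; rewrite mul0r.
Qed.

Lemma patterned_lower (R : comNzRingType) th (b M : 'I_d -> 'M[R]_n) :
  (forall a, is_trig_mx (b a)) -> deficient th -> patterned th M ->
  patterned th (fun a => b a *m M a).
Proof.
move=> bt /andP[_ /forallP sth] [A fA MA].
pose A' i := if i is inl (a, k) then if k == 0 then b a *m A i else A i else A i.
exists A' => [[[a k]|k]|a] /=; try exact: fA; last by rewrite MA !mulmxA.
case: eqP => [->|_]; last exact: fA.
have At : is_trig_mx (A (inl (a, 0))).
  by apply/fits_lower; have := fA (inl (a, 0)); rewrite (eqP (sth a)).
by rewrite (eqP (sth a)); apply/fits_lower/trig_mul.
Qed.

Lemma patterned_map (R S : comNzRingType) (g : {rmorphism R -> S}) th (M : 'I_d -> 'M[R]_n) :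
  patterned th M -> patterned th (fun a => map_mx g (M a)).
Proof.
case=> A fA MA; exists (fun i => map_mx g (A i)) => [i r c h|a].
  by rewrite mxE fA // rmorph_nat.
by rewrite MA !map_mxM.
Qed.

(** Expand P (Y M), for Y a tuple of generic lower triangular matrices, in
    monomials in the entries of Y.  As the patterned tuples are stable under Y,
    the coefficients, which are polynomials in M over K, stay in the ideal; and
    if P (b M) is nonzero then so is one of these coefficients at M. *)
Lemma pattern_ideal_lower (L : comNzRingType) (f : {rmorphism K -> L})
    (b M : 'I_d -> 'M[L]_n) P :
  (forall a, is_trig_mx (b a)) -> pattern_ideal P ->
  tuple_eval f (fun a => b a *m M a) P != 0 ->
  exists2 P', pattern_ideal P' & tuple_eval f M P' != 0.
Proof.
move=> bt IP nz.
pose Y (R : comNzRingType) a : 'M[{mpoly R[m]}]_n :=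
  \matrix_(r, c) if (c <= r)%N then 'X_(enum_rank (a, r, c)) else 0.
pose X a : 'M[entry_poly K n d]_n := \matrix_(r, c) 'X_(enum_rank (a, r, c)).
pose Q := @tuple_eval {mpoly (entry_poly K n d)[m]} (@mpolyC m _ \o @mpolyC m K)
  (fun a => Y (entry_poly K n d) a *m map_mx (@mpolyC m _) (X a)) P.
have Qeval (R : comNzRingType) (g : {rmorphism K -> R}) (N : 'I_d -> 'M[R]_n) :
    map_mpoly (tuple_eval g N) Q =
    tuple_eval (@mpolyC m R \o g) (fun a => Y R a *m map_mx (@mpolyC m R) (N a)) P.
  rewrite /Q tuple_eval_comp; apply: eq_tuple_eval => [x|a] /=.
    by rewrite map_mpolyC; congr (_%:MP); exact: tuple_evalC.
  rewrite map_mxM; congr (_ *m _); apply/matrixP => r c; rewrite !mxE.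
    by case: ifP => _; rewrite ?rmorph0 //= map_mpolyX.
  by rewrite /= map_mpolyC; congr (_%:MP); exact: tuple_evalX.
have /existsP : [exists e : 'X_{1..m < msize (map_mpoly (tuple_eval f M) Q)},
    tuple_eval f M (Q@_e) != 0].
  apply: contraNT nz; rewrite negb_exists => /forallP h0.
  have Q0 : map_mpoly (tuple_eval f M) Q = 0.
    apply/mpolyP => e; rewrite mcoeff0.
    have [lte|] := ltnP (mdeg e) (msize (map_mpoly (tuple_eval f M) Q)).
      by rewrite mcoeff_map_mpoly; have := h0 (BMultinom lte); rewrite negbK => /eqP.
    by move/msize_mdeg_ge/memN_msupp_eq0.
  pose h : {rmorphism {mpoly L[m]} -> L} :=
    mmap idfun (fun v => let t := enum_val v in b t.1.1 t.1.2 t.2).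
  have := congr1 h Q0; rewrite rmorph0 Qeval tuple_eval_comp => <-.
  apply/eqP/eq_tuple_eval => [x|a]; first by rewrite /h /= mmapC.
  rewrite map_mxM; congr (_ *m _); apply/matrixP => r c; rewrite !mxE.
    case: leqP => [_|rc]; first by rewrite /h /= mmapX mmap1U enum_rankK.
    by rewrite rmorph0; move/is_trig_mxP: (bt a); apply.
  by rewrite /h /= mmapC.
case=> e nze; move: (bmnm e) nze => {}e nze; exists Q@_e => // th sth R g N sN.
rewrite -(mcoeff_map_mpoly (tuple_eval g N)) Qeval.
rewrite (_ : tuple_eval _ _ _ = 0) ?mcoeff0 //.
apply: (IP th sth); apply: patterned_lower => //; last exact: patterned_map.
by move=> a; apply/is_trig_mxP => r c rc; rewrite mxE leqNgt rc.
Qed.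

Definition generic_flags : flags_subset K n d := fun L iota E =>
  exists2 M : 'I_d -> 'M[L]_n, forall a, adapted_basis (M a) (E a) &
  exists2 P, pattern_ideal P & entry_eval iota M P <> 0.

Lemma generic_flags_open : zariski_open generic_flags.
Proof.
exists pattern_ideal => L iota M E aM; split; last by exists M.
case=> M' aM' [P IP /eqP nz].
have bM : (fun a => M' a *m invmx (M a) *m M a) =1 M'.
  by move=> a; rewrite mulmxKV //; have [] := aM a.
have nz' : tuple_eval iota (fun a => M' a *m invmx (M a) *m M a) P != 0.
  by rewrite (eq_tuple_eval _ (frefl iota) bM); exact: nz.
have bt a : is_trig_mx (M' a *m invmx (M a)) by apply: adapted_trig (aM a) (aM' a).
have [P' IP' /eqP] := pattern_ideal_lower bt IP nz'.
by exists P'.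
Qed.

(** A nonempty open set gives a nonzero polynomial Q, and neither Q nor a nonzero
    element of the ideal vanishes at the matrices whose entries are independent
    variables. *)
Lemma generic_flags_dense : zariski_dense generic_flags.
Proof.
move=> V [IV VP] [L [iota [E VE]]].
have /fin_all_exists[M0 aM0] a := flag_has_basis (E a).
have /(VP _ _ _ _ aM0)[Q IQ nzQ] := VE.
have [P IP nzP] := pattern_ideal_neq0.
pose L' : fieldType := {fraction entry_poly K n d}.
pose X a : 'M[entry_poly K n d]_n := \matrix_(r, c) 'X_(enum_rank (a, r, c)).
pose iota' : {rmorphism K -> L'} := @tofrac (entry_poly K n d) \o @mpolyC m K.
pose M a : 'M[L']_n := map_mx (@tofrac (entry_poly K n d)) (X a).
have evalX S : entry_eval iota' M S = tofrac S.
  rewrite -[LHS]/(tuple_eval iota' M S) -tuple_eval_comp; congr tofrac.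
  rewrite -[RHS]comp_mpoly_id /tuple_eval /comp_mpoly /mmap.
  apply: eq_bigr => e _; congr (_ * _); apply: eq_bigr => v _.
  by rewrite tnth_mktuple mxE -!surjective_pairing enum_valK.
have Mu a : M a \in unitmx.
  rewrite unitmxE unitfE det_map_mx tofrac_eq0.
  apply: contraTneq isT => dX0.
  have := congr1 (tuple_eval idfun (fun=> 1%:M)) dX0.
  rewrite rmorph0 -det_map_mx (_ : map_mx _ _ = 1%:M) ?det1.
    by move/eqP; rewrite oner_eq0.
  apply/matrixP => r c; rewrite [LHS]mxE.
  have -> : X a r c = 'X_(enum_rank (a, r, c)) by rewrite mxE.
  exact: (@tuple_evalX K idfun (fun=> 1%:M)).
have /fin_all_exists[E' aE'] a := flag_of_basis (Mu a).
exists L', iota', E'; split.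
  apply/(VP _ _ _ _ aE'); exists Q => //; rewrite evalX; apply/eqP.
  rewrite tofrac_eq0; apply: contra_not_neq nzQ => ->; exact: rmorph0.
exists M => //; exists P => //; rewrite evalX; apply/eqP.
by rewrite tofrac_eq0.
Qed.
End Patterns.

(** * Relative position and Bruhat decomposition *)

Definition pos_count n (t : 'S_n) (i j : nat) : nat :=
  #|[set c : 'I_n | (c < j) && (t c < i)]%N|.

(** The permutation of which [position_mx] is the matrix: the 1 in column c is
    in row [rev_perm w c]. *)
Definition rev_perm n (w : 'S_n) : 'S_n := (perm (@rev_ord_inj n) * w)%g.

Lemma rev_permE n (w : 'S_n) c : rev_perm w c = w (rev_ord c).
Proof. by rewrite permM permE. Qed.

(** The submatrix factors through the columns that it meets, X and Y being
    inclusions of coordinates with left and right inverses X^T and Y^T. *)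
Lemma rank_position (K : fieldType) n (w : 'S_n) (i j : 'I_n.+1) :
  \rank (position_submx K w i j) = pos_count (rev_perm w) i j.
Proof.
set t := rev_perm w; rewrite /pos_count; set S := [set _ | _].
pose X : 'M[K]_(i, #|S|) := \matrix_(r, s) (nat_of_ord r == nat_of_ord (t (@enum_val _ (mem S) s)))%:R.
pose Y : 'M[K]_(#|S|, j) := \matrix_(s, c) (nat_of_ord c == nat_of_ord (@enum_val _ (mem S) s))%:R.
have XX : X^T *m X = 1%:M.
  apply/matrixP => s s'; rewrite !mxE.
  have := enum_valP s; rewrite inE => /andP[_ lt].
  rewrite (bigD1 (Ordinal lt)) //= big1 ?addr0.
    rewrite !mxE /= eqxx mul1r; congr (_%:R)%R; congr nat_of_bool.
    by rewrite (inj_eq (@ord_inj _)) (inj_eq perm_inj) (inj_eq enum_val_inj).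
  by move=> r rs; rewrite !mxE (negPf (rs : (r != _ :> nat))) mul0r.
have YY : Y *m Y^T = 1%:M.
  apply/matrixP => s s'; rewrite !mxE.
  have := enum_valP s; rewrite inE => /andP[lt _].
  rewrite (bigD1 (Ordinal lt)) //= big1 ?addr0.
    rewrite !mxE /= eqxx mul1r; congr (_%:R)%R; congr nat_of_bool.
    by rewrite (inj_eq (@ord_inj _)) (inj_eq enum_val_inj).
  by move=> r rs; rewrite !mxE (negPf (rs : (r != _ :> nat))) mul0r.
have AE : position_submx K w i j = X *m Y.
  apply/matrixP => r c; rewrite !mxE -rev_permE -/t.
  have [/(congr1 (@nat_of_ord n))/= rc|nrc] := eqVneq (widen_ord _ r) _.
    have cS : widen_ord (leq_ord j) c \in S by rewrite inE /= ltn_ord -rc ltn_ord.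
    rewrite (bigD1 (enum_rank_in cS (widen_ord (leq_ord j) c))) //= big1 ?addr0.
      by rewrite !mxE enum_rankK_in // rc !eqxx mulr1.
    move=> s; rewrite -(inj_eq enum_val_inj) enum_rankK_in // => sc.
    by rewrite !mxE [((c : nat) == _)]eq_sym (negPf (sc : (_ != _ :> nat))) mulr0.
  rewrite big1 // => s _; rewrite !mxE; case: (c =P _ :> nat) => [e|_]; last by rewrite mulr0.
  rewrite mulr1; case: eqP => // e'; case/eqP: nrc; apply/val_inj; rewrite /= e'.
  by congr (nat_of_ord (t _)); apply/val_inj.
apply/eqP; rewrite AE eqn_leq mulmx_max_rank /=.
have key : X^T *m (X *m Y) *m Y^T = 1%:M by rewrite !mulmxA XX mul1mx YY.
rewrite -[X in (X <= _)%N](mxrank1 K) -key.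
by apply: leq_trans (mxrankM_maxl _ _) _; apply: mxrankM_maxr.
Qed.

Definition meets_as (L : fieldType) n (E F : flag L n) (t : 'S_n) :=
  forall i j : 'I_n.+1, \dim (E i :&: F j) = pos_count t i j.

Lemma relative_meets (L : fieldType) n (E F : flag L n) (w : 'S_n) :
  relative_position E F w -> meets_as E F (rev_perm w).
Proof.
move=> EF i j; case: (posnP i) => [i0|i_gt0].
  rewrite i0 /pos_count (_ : [set _ | _] = set0).
    rewrite cards0; apply/eqP; rewrite -leqn0.
    by have := dimvS (capvSl (E i) (F j)); rewrite flag_dim i0.
  by apply/setP => c; rewrite !inE ltn0 andbF.
case: (posnP j) => [j0|j_gt0]; last by rewrite -(rank_position L) EF.
rewrite j0 /pos_count (_ : [set _ | _] = set0).
  rewrite cards0; apply/eqP; rewrite -leqn0.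
  by have := dimvS (capvSr (E i) (F j)); rewrite flag_dim j0.
by apply/setP => c; rewrite !inE ltn0.
Qed.

Section Bruhat.
Variables (L : fieldType) (n : nat).
Implicit Types (E F : flag L n) (t : 'S_n) (G M : 'M[L]_n) (v : 'rV[L]_n).

(** The row c of a basis adapted to F spans F (hi c), of dimension c + 1, modulo
    F (lo c), of dimension c. *)
Notation lo c := (widen_ord (leqnSn n) c).
Notation hi c := (lift ord0 c).

Lemma adapted_mem G F (i : 'I_n.+1) v : adapted_basis G F ->
  reflect (forall c : 'I_n, (i <= c)%N -> (v *m invmx G) 0 c = 0) (v \in F i).
Proof.
move=> aG; rewrite (adaptedE aG); apply: (iffP (row_spanP _ _ aG.1)) => h c.
  by move=> ic; rewrite h // inE -leqNgt.
by rewrite inE -leqNgt => /h.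
Qed.

(** Passing from F (lo k) to F (hi k) enlarges the intersection with E i
    only when t k < i. *)
Lemma pivot E F t i v (k : 'I_n) : meets_as E F t ->
  v \in E i -> v \in F (hi k) -> v \notin F (lo k) -> (t k < i)%N.
Proof.
move=> EF vE vhi; apply: contraR; rewrite -leqNgt => ik.
have sub : (F (lo k) <= F (hi k))%VS by apply: flag_sub; rewrite /= /bump leq0n leqnSn.
have /eqP eqF : (E i :&: F (lo k))%VS == (E i :&: F (hi k))%VS.
  rewrite eqEdim capvS //= !EF; apply: subset_leq_card; apply/subsetP=> c.
  rewrite !inE /= /bump leq0n ltnS leq_eqVlt => /andP[/predU1P[/val_inj->|->//]].
  by rewrite ltnNge ik.
have : v \in (E i :&: F (hi k))%VS by rewrite memv_cap vE.
by rewrite -eqF memv_cap => /andP[].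
Qed.

Lemma last_nonzero v : v != 0 ->
  exists2 k, v 0 k != 0 & forall c : 'I_n, (k < c)%N -> v 0 c = 0.
Proof.
move=> /rV0Pn[k0 k0P].
case: (@arg_maxnP _ k0 (fun k => v 0 k != 0) (@nat_of_ord n) k0P) => k kP kmax.
exists k => // c; apply: contraTeq => /kmax; by rewrite -leqNgt.
Qed.

(** The space E (hi (t c)) :&: F (hi c) has exactly one dimension more than
    the number of coordinates that are to vanish, and any nonzero vector of
    it where they vanish has its last nonzero coordinate at c, by [pivot]. *)
Lemma bruhat_row E F t G c : meets_as E F t -> adapted_basis G F ->
  exists v : 'rV[L]_n,
   [/\ v \in E (hi (t c)), v \notin E (lo (t c)),
    (v *m invmx G) 0 c = 1,
    forall k : 'I_n, (c < k)%N -> (v *m invmx G) 0 k = 0 &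
    forall k : 'I_n, (k < c)%N -> (t k < t c)%N -> (v *m invmx G) 0 k = 0].
Proof.
move=> EF aG; have Gu := aG.1.
pose Z := [set k : 'I_n | (k < c) && (t k < t c)]%N.
pose W := (E (hi (t c)) :&: F (hi c))%VS.
have dW : \dim W = #|Z|.+1.
  rewrite EF /pos_count (_ : [set _ | _] = c |: Z) ?cardsU1 ?inE ?ltnn //.
  apply/setP=> k; rewrite !inE /= /bump !leq0n !add1n !ltnS.
  have [->|nkc] := eqVneq k c; first by rewrite !leqnn.
  have e1 : (k == c :> nat) = false by apply: negPf.
  have e2 : (t k == t c :> nat) = false.
    by apply: negPf; rewrite -(inj_eq (@perm_inj _ t)) in nkc; exact: nkc.
  by rewrite [(k <= c)%N]leq_eqVlt [(t k <= t c)%N]leq_eqVlt e1 e2.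
(* v in W satisfies #|Z| linear conditions, one less than the dimension *)
have /subvPn[v] : ~~ (W :&: row_span G (~: Z) <= 0)%VS.
  rewrite subv0 -dimv_eq0 -lt0n.
  by have := dim_cap_row_span W Z Gu; rewrite dW addnC -addn1 leq_add2l.
rewrite memv0 2!memv_cap => /andP[/andP[vE vF] vZ] v0.
have coordZ k : k \in Z -> (v *m invmx G) 0 k = 0.
  by move=> kZ; apply: (row_spanP _ _ Gu vZ); rewrite inE kZ.
have vhi (k : 'I_n) : (c < k)%N -> (v *m invmx G) 0 k = 0.
  by move=> ck; apply: (adapted_mem _ _ aG vF).
have w0 : v *m invmx G != 0.
  by apply: contraNneq v0 => w0; rewrite -[v](mulmxKV Gu) w0 mul0mx.
have vc : (v *m invmx G) 0 c != 0.
  have [k wk wmax] := last_nonzero w0.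
  have kc : (k <= c)%N by rewrite leqNgt; apply: contra wk => /vhi->.
  have tk : (t k < hi (t c))%N.
    apply: (pivot EF vE); first by apply/(adapted_mem _ _ aG) => l; exact: wmax.
    by apply: contra wk => /(adapted_mem _ _ aG)->.
  move: tk; rewrite /= /bump leq0n ltnS leq_eqVlt => /predU1P[|tk].
    by move=> /val_inj/perm_inj <-.
  move: kc; rewrite leq_eqVlt => /predU1P[/val_inj<- //|kc].
  by rewrite coordZ ?eqxx // inE kc in wk.
have vlo : v \notin E (lo (t c)).
  apply/negP => vlo; have := pivot EF vlo vF; rewrite /= ltnn => h.
  suff /h : v \notin F (lo c) by [].
  by apply: contra vc => /(adapted_mem _ _ aG)->.
pose k := ((v *m invmx G) 0 c)^-1.
have k0 : k != 0 by rewrite invr_eq0.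
have wE : k *: v *m invmx G = k *: (v *m invmx G) by rewrite scalemxAl.
exists (k *: v); rewrite wE; split.
- exact: memvZ.
- by apply: contra vlo => /(memvZ k^-1); rewrite scalerA mulVf // scale1r.
- by rewrite mxE mulVf.
- by move=> l cl; rewrite mxE vhi ?mulr0.
- by move=> l lc tl; rewrite mxE coordZ ?mulr0 // inE lc.
Qed.

(** The rows of N are in echelon form relative to a basis adapted to F, the one
    with pivot in column c being row t c; the entries at the pivots of earlier
    rows are cleared, which leaves as many free entries as t has inversions. *)
Lemma bruhat E F t M G : meets_as E F t -> adapted_basis M E -> adapted_basis G F ->
  exists b N : 'M[L]_n, [/\ M = b *m (N *m G), is_trig_mx b, adapted_basis (N *m G) E,
    forall c k : 'I_n, (c <= k)%N -> N (t c) k = (k == c)%:R &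
    forall c k : 'I_n, (k < c)%N -> (t k < t c)%N -> N (t c) k = 0].
Proof.
move=> EF aM aG; have Gu := aG.1.
have /fin_all_exists[v vP] c := bruhat_row c EF aG.
pose N := \matrix_r (v (t^-1%g r) *m invmx G).
have rowN c k : N (t c) k = (v c *m invmx G) 0 k by rewrite mxE permK.
have rowV r : row r (N *m G) = v (t^-1%g r).
  by rewrite row_mul rowK mulmxKV.
have aV : adapted_basis (N *m G) E.
  apply: (staircase_adapted aM) => r; rewrite rowV; have [] := vP (t^-1%g r);
  by rewrite permKV.
exists (M *m invmx (N *m G)), N; split => //.
- by rewrite mulmxKV //; case: aV.
- exact: adapted_trig aV aM.
- move=> c k; rewrite rowN; case: (vP c) => _ _ h1 h _.
  rewrite leq_eqVlt => /predU1P[/val_inj<-|ck]; first by rewrite h1 eqxx.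
  by rewrite h // -val_eqE (gtn_eqF ck).
- by move=> c k; rewrite rowN; case: (vP c) => _ _ _ _; apply.
Qed.

(** When E y contains the row j of G, row t j of the echelon form can be
    traded for the vector e_j, from which it differs by a combination of other
    rows.  The rows above t j are absorbed in b; those below have index less
    than y, and their coefficients form the factor C.  Hence, compared
    with [bruhat], the entries of row t j that correspond to rows of index at
    least y are no longer free. *)
Lemma bruhat_through E F t M G (j : 'I_n) (y : 'I_n.+1) :
  meets_as E F t -> adapted_basis M E -> adapted_basis G F -> row j G \in E y ->
  exists b C N : 'M[L]_n, [/\ M = b *m (C *m N) *m G, is_trig_mx b,
    forall r c : 'I_n, ~~ [&& r == t j, t j < c < y & t^-1%g c < j]%N -> C r c = (r == c)%:R &
    forall r c : 'I_n, ~~ [&& r != t j, c < t^-1%g r & r < t c]%N -> N r c = (c == t^-1%g r)%:R].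
Proof.
move=> EF aM aG jE; have Gu := aG.1.
have [b [N [Mb bt aV N1hi Nlo]]] := bruhat EF aM aG.
have N1 c : N (t c) c = 1 by rewrite N1hi // eqxx.
have Nhi (c k : 'I_n) : (c < k)%N -> N (t c) k = 0.
  by move=> ck; rewrite N1hi 1?ltnW // -val_eqE (gtn_eqF ck).
set r0 := t j.
(* d : the coordinates of e_j on the rows of N *)
pose d : 'rV[L]_n := row j G *m invmx (N *m G).
have dN : d *m N = delta_mx 0 j.
  by rewrite -[LHS](mulmxK Gu) -[d *m N *m G]mulmxA mulmxKV ?aV.1 // rowE mulmxK.
have dy (r : 'I_n) : (y <= r)%N -> d 0 r = 0 by apply: (adapted_mem _ _ aV jE).
(* sorting the rows by their pivots makes N lower unitriangular *)
pose N' := row_perm t N; pose d' := col_perm t d.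
have N't : is_trig_mx N' by apply/is_trig_mxP => c k ck; rewrite mxE Nhi.
have N'u : N' \in unitmx.
  rewrite unitmxE det_trig // big1 ?unitr1 // => c _; by rewrite mxE N1.
have d'N' : d' *m N' = delta_mx 0 j.
  rewrite -dN; apply/rowP => k; rewrite !mxE [RHS](reindex_inj (@perm_inj _ t)) /=.
  by apply: eq_bigr => c _; rewrite !mxE.
have djhi (c : 'I_n) : (j < c)%N -> d 0 (t c) = 0.
  move=> jc; have /is_trig_mxP/(_ j c jc) := trig_inv N'u N't.
  have : d' = row j (invmx N') by rewrite rowE -d'N' mulmxK.
  by move/rowP/(_ c); rewrite !mxE => ->.
have dr0 : d 0 r0 = 1.
  have /rowP/(_ j) := d'N'; rewrite !mxE !eqxx (bigD1 j) //= big1.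
    by rewrite !mxE N1 mulr1 addr0.
  move=> c cj; rewrite [d' 0 c]mxE [N' c j]mxE; case: (ltngtP c j) => [lcj|ljc|/val_inj ecj].
  - by rewrite Nhi ?mulr0.
  - by rewrite djhi ?mul0r.
  - by rewrite ecj eqxx in cj.
clearbody d.
(* N2 := N + (X + Y) *m N is N with row r0 replaced by e_j, and the matrices
   X and Y, supported on row r0, multiply to 0 *)
pose e : 'cV[L]_n := delta_mx r0 0.
pose low : 'rV[L]_n := \row_r if (r < r0)%N then d 0 r else 0.
pose up : 'rV[L]_n := \row_r if (r0 < r)%N then d 0 r else 0.
have dE : d = delta_mx 0 r0 + (low + up).
  apply/rowP => r; rewrite !mxE eqxx /=; case: (ltngtP r r0) => [lt|gt|/val_inj->].
  - by rewrite -val_eqE /= (ltn_eqF lt) add0r addr0.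
  - by rewrite -val_eqE /= (gtn_eqF gt) !add0r.
  - by rewrite eqxx dr0 !addr0.
have entry (w : 'rV[L]_n) r c : (e *m w) r c = (r == r0)%:R * w 0 c.
  by rewrite mxE big_ord1 mxE andbT.
have lowe (x : 'rV[L]_n) (w : 'rV[L]_n) : x 0 r0 = 0 -> e *m x *m (e *m w) = 0.
  move=> x0; rewrite -mulmxA [x *m _]mulmxA (_ : x *m e = 0) ?mul0mx ?mulmx0 //.
  by rewrite -colE; apply/matrixP => a a'; rewrite !ord1 !mxE.
have low0 : low 0 r0 = 0 by rewrite mxE ltnn.
have up0 : up 0 r0 = 0 by rewrite mxE ltnn.
pose X := e *m low; pose Y := e *m up.
have key : (1%:M - X) *m (1%:M - Y) *m (1%:M + (X + Y)) = 1%:M.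
  have XY : X *m Y = 0 by apply: lowe.
  have zXY (Z : 'M[L]_n) : X *m Z = 0 -> Y *m Z = 0 -> (X + Y) *m Z = 0.
    by move=> XZ YZ; rewrite mulmxDl XZ YZ addr0.
  have sq : (X + Y) *m (X + Y) = 0.
    by apply: zXY; rewrite mulmxDr !lowe ?addr0.
  have -> : (1%:M - X) *m (1%:M - Y) = 1%:M - (X + Y).
    by rewrite mulmxBr mulmx1 mulmxBl mul1mx XY subr0 opprD addrA.
  by rewrite mulmxBl mul1mx mulmxDr mulmx1 sq addr0 addrK.
exists (b *m (1%:M - X)), (1%:M - Y), (N + (X + Y) *m N); split.
- rewrite {1}Mb [in LHS]mulmxA; congr (_ *m _); rewrite -mulmxA; congr (_ *m _).
  by rewrite -{2}[N]mul1mx -mulmxDl !mulmxA key mul1mx.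
- apply: trig_mul => //; apply/is_trig_mxP => r c rc.
  rewrite !mxE -val_eqE /= (ltn_eqF rc) sub0r big_ord1 !mxE andbT.
  case: eqP => [er|_]; last by rewrite mul0r oppr0.
  by rewrite ltnNge -er (ltnW rc) /= mulr0 oppr0.
- move=> r c h; rewrite mxE [in X in _ + X]mxE entry mxE mxE.
  case: (r =P r0) h => /= [_ h|_ _]; last by rewrite mul0r subr0.
  rewrite mul1r; case: ltnP h => /= [r0c h|_ _]; last by rewrite subr0.
  rewrite (_ : d 0 c = 0) ?subr0 //.
  move: h; rewrite negb_and -!leqNgt => /orP[/dy//|]; rewrite leq_eqVlt => /predU1P[jc|jc].
    by move: r0c; rewrite /r0 (val_inj jc) permKV ltnn.
  by rewrite -[c](permKV t) djhi.
- move=> r c h; rewrite mxE -mulmxDr -mulmxA entry mxE.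
  case: (r =P r0) h => /= [->|/eqP rr0 h].
    rewrite mul1r permK => _.
    have : (low + up) *m N = delta_mx 0 j - row r0 N.
      by rewrite -dN dE [(delta_mx _ _ + _) *m _]mulmxDl -rowE [X in X - _]addrC addrK.
    by move/rowP/(_ c); rewrite [LHS]mxE => ->; rewrite !mxE addrC subrK.
  rewrite mul0r addr0.
  have er : r = t (t^-1%g r) by rewrite permKV.
  case: (ltngtP c (t^-1%g r)) h => [lt|gt _|eq _].
  - rewrite -leqNgt leq_eqVlt => /predU1P[tc|tc].
      by move: lt; rewrite -(val_inj tc) permK ltnn.
    by rewrite er Nlo ?permKV // -val_eqE (ltn_eqF lt).
  - by rewrite {1}er Nhi // -val_eqE (gtn_eqF gt).
  - by rewrite (val_inj eq) eqxx {1}er N1.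
Qed.
End Bruhat.

(** * Bases adapted to F through a vector of T *)

(** The transpose of an LUP decomposition.  It parametrizes flags: up to a
    permutation of the coordinates, every flag has an adapted basis that is
    upper unitriangular. *)
Lemma upper_perm_decomp (L : fieldType) n (A : 'M[L]_n) : A \in unitmx ->
  exists b U (s : 'S_n), [/\ A = b *m (U *m perm_mx s), is_trig_mx b &
    forall r c : 'I_n, (c <= r)%N -> U r c = (r == c)%:R].
Proof.
case: n A => [|n] A Au.
  exists A, 1%:M, 1%g; split; last by case.
    by apply/matrixP; case.
  by apply/is_trig_mxP; case.
have := cormen_lup_correct A^T; have := cormen_lup_perm A^T.
have := @cormen_lup_lower _ _ A^T; have := @cormen_lup_upper _ _ A^T.
case: cormen_lup => [[P B] U] /= Uu Bl /is_perm_mxP[s ->] E.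
exists U^T, B^T, s; split.
- have := congr1 trmx E; rewrite -[perm_mx s * _]/(perm_mx s *m A^T) -[B * U]/(B *m U).
  rewrite !trmx_mul trmxK tr_perm_mx => h.
  by rewrite mulmxA -h -mulmxA -perm_mxM mulVg perm_mx1 mulmx1.
- by apply/is_trig_mxP => r c rc; rewrite mxE Uu.
- by move=> r c cr; rewrite mxE Bl // eq_sym.
Qed.

Section BasisThrough.
Variables (L : fieldType) (n : nat).
Implicit Types (E F : flag L n) (t : 'S_n) (G M : 'M[L]_n) (v : 'rV[L]_n).

Notation lo c := (widen_ord (leqnSn n) c).
Notation hi c := (lift ord0 c).

(** Starting from a vector of T outside F (lo j), coordinates of index less than
    j can be killed one at a time, as long as the vectors of T with the
    previous ones equal to 0 meet F (lo j) nontrivially; this gives \dim T - 1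
    zeros.  J is the set of the remaining coordinates below j. *)
Lemma pick_vector G F (T : {vspace 'rV[L]_n}) (j : 'I_n) :
  adapted_basis G F -> (T <= F (hi j))%VS -> ~~ (T <= F (lo j))%VS ->
  exists (J : {set 'I_n}) u, [/\ (#|J| + \dim T <= j.+1)%N, u \in T,
    forall k, k \in J -> (k < j)%N, (u *m invmx G) 0 j = 1 &
    forall k, k != j -> k \notin J -> (u *m invmx G) 0 k = 0].
Proof.
move=> aG Thi Tlo; have Gu := aG.1.
have sub1 : (F (lo j) <= F (hi j))%VS by apply: flag_sub; rewrite /= /bump leq0n leqnSn.
have claim m : (m < \dim T)%N -> exists (Z : {set 'I_n}) u,
    [/\ #|Z| = m, Z \subset initial n j, u \in T, u \notin F (lo j) & u \in row_span G (~: Z)].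
  elim: m => [_|m IHm ltm].
    have /subvPn[u uT ulo] := Tlo; exists set0, u; split => //; rewrite ?cards0 ?sub0set //.
    by apply/(row_spanP _ _ Gu) => c; rewrite !inE.
  have [Z [u [Zm Zj uT ulo uZ]]] := IHm (ltnW ltm).
  pose S := (T :&: row_span G (~: Z))%VS.
  have /subvPn[z] : ~~ (S :&: F (lo j) <= 0)%VS.
    rewrite subv0 -dimv_eq0 -lt0n.
    have := dimv_sum_cap S (F (lo j)).
    have : (\dim (S + F (lo j)) <= \dim (F (hi j)))%N.
      by apply: dimvS; rewrite subv_add sub1 (subv_trans (capvSl _ _)).
    have := dim_cap_row_span T Z Gu; rewrite -/S Zm !flag_dim /= /bump /=; lia.
  rewrite memv0 !memv_cap => /andP[/andP[zT zZ] zlo] z0.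
  have w0 : z *m invmx G != 0.
    by apply: contraNneq z0 => w0; rewrite -[z](mulmxKV Gu) w0 mul0mx.
  have [k zk _] := last_nonzero w0.
  have kj : (k < j)%N.
    rewrite ltnNge; apply: contra zk => jk; apply/eqP.
    exact: (adapted_mem _ _ aG zlo).
  have kZ : k \notin Z.
    apply: contra zk => kZ; apply/eqP.
    by apply: (row_spanP _ _ Gu zZ); rewrite inE kZ.
  pose q := (u *m invmx G) 0 k / (z *m invmx G) 0 k.
  exists (k |: Z), (u - q *: z); split.
  - by rewrite cardsU1 kZ Zm.
  - by rewrite subUset sub1set inE kj.
  - by rewrite memvB ?memvZ.
  - apply: contra ulo => h; rewrite -[u](subrK (q *: z)).
    by rewrite memvD // memvZ.
  - apply/(row_spanP _ _ Gu) => c; rewrite !inE negbK mulmxBl -scalemxAl.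
    rewrite mxE [X in _ + X]mxE [X in _ - X]mxE => /predU1P[->|cZ]; first by rewrite divfK // subrr.
    rewrite (row_spanP _ _ Gu uZ) ?inE ?cZ // (row_spanP _ _ Gu zZ) ?inE ?cZ //.
    by rewrite mulr0 subr0.
have T0 : (0 < \dim T)%N.
  by rewrite lt0n dimv_eq0; apply: contraNneq Tlo => ->; rewrite sub0v.
have [|Z [u [Zm Zj uT ulo uZ]]] := claim (\dim T).-1; first by rewrite prednK.
have uhi (c : 'I_n) : (j < c)%N -> (u *m invmx G) 0 c = 0.
  by move=> jc; apply: (adapted_mem _ _ aG (subvP Thi _ uT)).
have uj : (u *m invmx G) 0 j != 0.
  apply: contra ulo => /eqP uj; apply/(adapted_mem _ _ aG) => c /=.
  by rewrite leq_eqVlt => /predU1P[/val_inj<-|/uhi].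
set q := (u *m invmx G) 0 j in uj.
exists (initial n j :\: Z), (q^-1 *: u); rewrite -!scalemxAl; split.
- have := cardsID Z (initial n j); rewrite (setIidPr Zj) (card_initial (lo j)) Zm /=; lia.
- exact: memvZ.
- by move=> k; rewrite !inE => /andP[].
- by rewrite mxE mulVf.
- move=> k kj; rewrite !inE negb_and negbK mxE => /orP[kZ|].
    by rewrite (row_spanP _ _ Gu uZ) ?mulr0 // inE kZ.
  by rewrite -leqNgt leq_eqVlt eq_sym (negPf (kj : (k != j :> nat))) /= => /uhi->; rewrite mulr0.
Qed.

(** H is the identity except in row j, which holds the coordinates of the vector
    found by [pick_vector]; only #|J| of its entries are free. *)
Lemma adapted_basis_through F (T : {vspace 'rV[L]_n}) (j : 'I_n) :
  (T <= F (hi j))%VS -> ~~ (T <= F (lo j))%VS ->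
  exists (J : {set 'I_n}) (H U : 'M[L]_n) (s : 'S_n),
  [/\ (#|J| + \dim T <= j.+1)%N, adapted_basis (H *m (U *m perm_mx s)) F,
     row j (H *m (U *m perm_mx s)) \in T,
     forall r c : 'I_n, ~~ ((r == j) && (c \in J)) -> H r c = (r == c)%:R &
     forall r c : 'I_n, (c <= r)%N -> U r c = (r == c)%:R].
Proof.
move=> Thi Tlo; have [G0 aG0] := flag_has_basis F.
have [b [U [s [G0E bt Uu]]]] := upper_perm_decomp aG0.1.
set G := U *m perm_mx s in G0E.
have Gu : G \in unitmx by move: aG0.1; rewrite G0E unitmx_mul => /andP[].
have bu : b \in unitmx by move: aG0.1; rewrite G0E unitmx_mul => /andP[].
have aG : adapted_basis G F.
  apply: adaptedP => // r; apply/(adapted_mem _ _ aG0) => c rc.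
  have -> : G = invmx b *m G0 by rewrite G0E mulKmx.
  rewrite -row_mul mulmxK ?aG0.1 // mxE.
  by have /is_trig_mxP := trig_inv bu bt; apply.
have [J [u [JT uT Jj uj uJ]]] := pick_vector aG Thi Tlo.
pose H : 'M[L]_n := \matrix_(r, c) if r == j then (u *m invmx G) 0 c else (r == c)%:R.
have rowj : row j (H *m G) = u.
  rewrite row_mul -[RHS](mulmxKV Gu); congr (_ *m _).
  by apply/rowP => c; rewrite [LHS]mxE [LHS]mxE eqxx.
have rowr r : r != j -> row r (H *m G) = row r G.
  move=> rj; rewrite row_mul [RHS]rowE; congr (_ *m _).
  by apply/rowP => c; rewrite !mxE (negPf rj) eqxx eq_sym.
exists J, H, U, s; rewrite -/G; split => //; last 2 first.
- by rewrite rowj.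
- move=> r c; rewrite mxE; case: (r =P j) => [->|//] /= cJ.
  by have [<-|jc] := eqVneq j c; rewrite ?uj ?uJ // eq_sym.
apply: (staircase_adapted aG) => r.
  have [->|rj] := eqVneq r j; last by rewrite rowr // row_adapted.
  by rewrite rowj (subvP Thi).
have [->|rj] := eqVneq r j.
  rewrite rowj; apply/negP => /(adapted_mem _ _ aG)/(_ j (leqnn _))/eqP.
  by rewrite uj oner_eq0.
rewrite rowr //; apply/negP => /(adapted_mem _ _ aG)/(_ r (leqnn _))/eqP.
by rewrite -row_mul mulmxV // !mxE eqxx oner_eq0.
Qed.
End BasisThrough.

(** * Counting the parameters *)

Section Count.
Variable n : nat.
Implicit Types (t w : 'S_n) (j : 'I_n).

(** The free entries of the factor C in [bruhat_through]. *)
Definition mix_slots t j (y : nat) : {set 'I_n * 'I_n} :=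
  [set p : 'I_n * 'I_n | [&& p.1 == t j, t j < p.2 < y & t^-1%g p.2 < j]%N].

(** The free entries of the factor N in [bruhat_through]. *)
Definition echelon_slots t j : {set 'I_n * 'I_n} :=
  [set p : 'I_n * 'I_n | [&& p.1 != t j, p.2 < t^-1%g p.1 & p.1 < t p.2]%N].

Definition above_diag : {set 'I_n * 'I_n} := [set p : 'I_n * 'I_n | p.1 < p.2]%N.

Lemma card_above_diag : #|above_diag| = 'C(n, 2).
Proof.
rewrite -bin2_sum big_mkord -sum1_card (eq_bigr (fun i : 'I_n => \sum_(k < n | (k < i)%N) 1)%N).
  rewrite pair_big_dep /= (reindex_inj (h := fun p : 'I_n * 'I_n => (p.2, p.1))).
    by apply: eq_bigl => p; rewrite inE.
  by case=> ? ? [? ?] [-> ->].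
by move=> i _; rewrite sum1dep_card (card_initial (widen_ord (leqnSn n) i)).
Qed.

Lemma card_lower : (#|(lower_shape n).1| + #|above_diag| = n * n)%N.
Proof.
rewrite -[RHS](_ : #|{: 'I_n * 'I_n}| = _)%N; last by rewrite card_prod card_ord.
rewrite -(cardsC above_diag) addnC; congr (_ + _)%N; apply: eq_card => p.
by rewrite !inE -leqNgt.
Qed.

Lemma card_noninversions w :
  #|[set p : 'I_n * 'I_n | (p.1 < p.2) && (rev_perm w p.1 < rev_perm w p.2)]%N| =
  perm_length w.
Proof.
pose f (p : 'I_n * 'I_n) := (rev_ord p.2, rev_ord p.1).
have fI : injective f by apply: (can_inj (g := f)) => -[a b]; rewrite /f /= !rev_ordK.
rewrite /perm_length -(card_preimset _ fI); apply: eq_card => -[k c].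
rewrite !inE /= !rev_permE; congr andb; last by rewrite !rev_ordK.
by have := ltn_ord k; have := ltn_ord c; lia.
Qed.

(** Both sets of slots correspond to inversions of t: the echelon slots to those
    whose second column is not j, the mixing slots to those with second column
    j and whose first column k has t k < y.  The inversions left over are
    counted by the codimension of E y :&: F (hi j) in F (hi j). *)
Lemma card_echelon_mix t j (y : nat) : (t j < y)%N ->
  (#|echelon_slots t j| + #|mix_slots t j y| + (j.+1 - pos_count t y j.+1) =
   #|[set p : 'I_n * 'I_n | (p.1 < p.2) && (t p.2 < t p.1)]%N|)%N.
Proof.
move=> ty; set I := [set p | _].
pose At : {set 'I_n * 'I_n} := [set p | p.2 == j].
pose By : {set 'I_n * 'I_n} := [set p | t p.1 < y]%N.
have perm_neq (a b : 'I_n) : (t a == t b) = (a == b) by apply: (inj_eq perm_inj).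
have -> : #|echelon_slots t j| = #|I :\: At|.
  pose f (p : 'I_n * 'I_n) := (t p.2, p.1).
  have fI : injective f by move=> [a b] [a' b'] [] /perm_inj-> ->.
  rewrite -(card_preimset _ fI); apply: eq_card => -[k c].
  by rewrite !inE /= permK perm_neq.
have -> : #|mix_slots t j y| = #|I :&: At :&: By|.
  pose f (p : 'I_n * 'I_n) := (t p.2, t p.1).
  have fI : injective f by move=> [a b] [a' b'] [] /perm_inj-> /perm_inj->.
  rewrite -(card_preimset _ fI); apply: eq_card => -[k c].
  rewrite !inE /= permK perm_neq; case: eqP => [->|_]; last by rewrite andbF.
  by rewrite andbT; case: (k < j)%N; rewrite ?andbF ?andbT.
have -> : (j.+1 - pos_count t y j.+1)%N = #|I :&: At :\: By|.
  pose S := [set c : 'I_n | c < j.+1]%N; pose S' := [set c : 'I_n | t c < y]%N.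
  have -> : pos_count t y j.+1 = #|S :&: S'|.
    by apply: eq_card => c; rewrite !inE.
  have <- : #|S| = j.+1 by rewrite (card_initial (lift ord0 j)).
  rewrite -(cardsID S' S) addKn.
  have fI : injective (fun k : 'I_n => (k, j)) by move=> a b [].
  rewrite -(card_imset _ fI); apply: eq_card => -[k c].
  rewrite !inE /= -leqNgt; apply/imsetP/idP => [[k' kS [-> ->]]|].
    move: kS; rewrite !inE -leqNgt ltnS eqxx andbT => /andP[yk].
    rewrite yk leq_eqVlt => /predU1P[/val_inj ekj|->]; last by rewrite (leq_trans ty).
    by rewrite ekj leqNgt ty in yk.
  case/andP=> yk /andP[/andP[kc tt] /eqP cj]; exists k; last by rewrite cj.
  by rewrite !inE -leqNgt yk ltnS -cj ltnW.
by rewrite -addnA cardsID addnC cardsID.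
Qed.

(** The number of parameters for a basis adapted to a flag in position w to F
    whose y-th member contains a given vector of F (hi j) outside F (lo j) is
    n ^ 2, less the length of w, less the codimension of E y :&: F (hi j). *)
Lemma card_flag_slots w j (y : nat) : (rev_perm w j < y)%N ->
  (#|(lower_shape n).1| + (#|mix_slots (rev_perm w) j y| + #|echelon_slots (rev_perm w) j|)
   + (perm_length w + (j.+1 - pos_count (rev_perm w) y j.+1)) = n * n)%N.
Proof.
move=> jy; rewrite -card_lower -card_noninversions.
have := card_echelon_mix jy; set t := rev_perm w => h.
suff : (#|[set p : 'I_n * 'I_n | (p.1 < p.2) && (t p.2 < t p.1)]%N| +
  #|[set p : 'I_n * 'I_n | (p.1 < p.2) && (t p.1 < t p.2)]%N| = #|above_diag|)%N by lia.
rewrite -(cardsID [set p : 'I_n * 'I_n | (t p.2 < t p.1)]%N above_diag).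
congr (_ + _)%N; apply: eq_card => -[k c]; rewrite !inE //= -leqNgt andbC.
apply: andb_id2r => kc; rewrite [RHS]leq_eqVlt; case: eqP => // /ord_inj/perm_inj ekc.
by rewrite ekc ltnn in kc.
Qed.
End Count.

Section Bound.
Variables (L : fieldType) (n d : nat).
Notation lo c := (widen_ord (leqnSn n) c).
Notation hi c := (lift ord0 c).

(** The factors are those of [bruhat_through] for each flag, then those of
    [adapted_basis_through] for F. *)
Definition incidence_pattern (w : 'I_d -> 'S_n) (j : 'I_n) (y : 'I_d -> 'I_n.+1)
    (J : {set 'I_n}) (s : 'S_n) : pattern n d :=
  [ffun i => match i with
   | inl (a, k) =>
       if k == 0 then lower_shape n
       else if k == 1 then (mix_slots (rev_perm (w a)) j (y a), \matrix_(r, c) (r == c))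
       else (echelon_slots (rev_perm (w a)) j, \matrix_(r, c) (c == (rev_perm (w a))^-1%g r))
   | inr k =>
       if k == 0 then ([set p | (p.1 == j) && (p.2 \in J)], \matrix_(r, c) (r == c))
       else if k == 1 then (above_diag n, \matrix_(r, c) (r == c))
       else (set0, \matrix_(r, c) (s r == c))
   end].

Lemma incidence_pattern_dim w j y J s :
  pattern_dim (incidence_pattern w j y J s) =
  (\sum_a (#|(lower_shape n).1| +
      (#|mix_slots (rev_perm (w a)) j (y a)| + #|echelon_slots (rev_perm (w a)) j|)) +
   (#|J| + 'C(n, 2)))%N.
Proof.
rewrite /pattern_dim big_sumType /=; congr (_ + _)%N.
  rewrite (eq_bigr (fun p : 'I_d * 'I_3 => #|(incidence_pattern w j y J s (inl (p.1, p.2))).1|)).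
    2: by case.
  rewrite -(pair_bigA _ (fun a k => #|(incidence_pattern w j y J s (inl (a, k))).1|)) /=.
  apply: eq_bigr => a _; rewrite !big_ord_recl big_ord0 !ffunE /=.
  by rewrite addn0.
rewrite !big_ord_recl big_ord0 !ffunE /= cards0 card_above_diag !addn0; congr (_ + _)%N.
have fI : injective (fun k : 'I_n => (j, k)) by move=> a b [].
rewrite -(card_imset _ fI); apply: eq_card => -[k c]; rewrite !inE /=.
apply/andP/imsetP => [[/eqP-> cJ]|[c' cJ [-> ->]]]; first by exists c.
by rewrite eqxx.
Qed.

(** A configuration with an intersection T larger than expected is patterned
    with fewer parameters than coordinates: #|J| <= j.+1 - \dim T is then less
    than the sum of the codimensions. *)
Lemma excess_patterned (E : 'I_d -> flag L n) (M : 'I_d -> 'M[L]_n) (F : flag L n)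
    (w : 'I_d -> 'S_n) (j : 'I_n) (y : 'I_d -> 'I_n.+1) (T : {vspace 'rV[L]_n}) :
  (forall a, adapted_basis (M a) (E a)) ->
  (\sum_(a < d) perm_length (w a) = 'C(n, 2))%N ->
  (forall a, relative_position (E a) F (w a)) ->
  (forall a, T <= E a (y a))%VS -> (T <= F (hi j))%VS -> ~~ (T <= F (lo j))%VS ->
  (j.+1 < \dim T + \sum_a (j.+1 - \dim (E a (y a) :&: F (hi j))))%N ->
  exists2 th, deficient th & patterned th M.
Proof.
move=> aM sumw EF TE Thi Tlo big.
have [J [H [U [s [JT aG jT Hsh Ush]]]]] := adapted_basis_through Thi Tlo.
set G := H *m (U *m perm_mx s) in aG jT.
have meets a := relative_meets (EF a).
have ty a : (rev_perm (w a) j < y a)%N.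
  have /subvPn[u uT ulo] := Tlo.
  by apply: pivot (meets a) (subvP (TE a) _ uT) (subvP Thi _ uT) ulo.
have /fin_all_exists[b /fin_all_exists[C /fin_all_exists[N bCN]]] a :=
  bruhat_through (meets a) (aM a) aG (subvP (TE a) _ jT).
exists (incidence_pattern w j y J s).
  apply/andP; split; last by apply/forallP => a; rewrite ffunE.
  rewrite incidence_pattern_dim card_prod card_prod !card_ord.
  have codE : (\sum_a (j.+1 - \dim (E a (y a) :&: F (hi j))) =
      \sum_a (j.+1 - pos_count (rev_perm (w a)) (y a) j.+1))%N.
    by apply: eq_bigr => a _; rewrite (meets a).
  rewrite codE in big.
  have <- : (\sum_(a < d) n * n = d * n * n)%N by rewrite sum_nat_const card_ord mulnA.
  rewrite -(eq_bigr _ (fun a _ => card_flag_slots (ty a))) !big_split /= sumw.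
  rewrite ltn_add2l addnC ltn_add2l -(ltn_add2r (\dim T)) [X in (_ < X)%N]addnC.
  exact: leq_ltn_trans JT big.
exists (fun i => match i with
   | inl (a, k) => if k == 0 then b a else if k == 1 then C a else N a
   | inr k => if k == 0 then H else if k == 1 then U else perm_mx s
   end).
  move=> [[a k]|k] r c; rewrite ffunE.
    have [_ bt Csh Nsh] := bCN a.
    case: eqP => _; first by apply/fits_lower: r c.
    case: eqP => _; rewrite inE /= mxE; [exact: Csh|exact: Nsh].
  case: eqP => _; first by rewrite inE mxE; apply: Hsh.
  case: eqP => _; first by rewrite inE mxE -leqNgt; apply: Ush.
  by rewrite !mxE.
by move=> a /=; have [-> _ _ _] := bCN a.
Qed.
End Bound.

(** * The recurrence *)

Local Open Scope nat_scope.

Lemma dim_cap_ge (L : fieldType) (vT : vectType L) (A B V : {vspace vT}) :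
  (A <= V)%VS -> (B <= V)%VS -> \dim A + \dim B <= \dim (A :&: B) + \dim V.
Proof.
move=> AV BV; rewrite -dimv_sum_cap addnC leq_add2l; apply: dimvS.
by rewrite subv_add AV.
Qed.

Lemma capv_distr (L : fieldType) (vT : vectType L) (A B V : {vspace vT}) :
  (A :&: B :&: V = (A :&: V) :&: (B :&: V))%VS.
Proof. by rewrite [RHS]capvA -(capvA A V B) (capvC V) capvA -[RHS]capvA capvv. Qed.

Lemma codim_bigcap (L : fieldType) (vT : vectType L) (I : Type) (r : seq I) (P : pred I)
    (W : I -> {vspace vT}) (V : {vspace vT}) :
  \dim V <= \dim ((\bigcap_(a <- r | P a) W a) :&: V) +
            \sum_(a <- r | P a) (\dim V - \dim (W a :&: V)).
Proof.
elim: r => [|a r IHr]; first by rewrite !big_nil capfv addn0.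
rewrite !big_cons; case: ifP => // _; set Y := (\bigcap_(_ <- _ | _) _)%VS in IHr *.
have := dim_cap_ge (capvSr (W a) V) (capvSr Y V).
rewrite -capv_distr.
set S := (\sum_(_ <- _ | _) _) in IHr *; lia.
Qed.

Theorem lemma5p3 (K : fieldType) (n d : nat) :
  exists U : flags_subset K n d,
    [/\ zariski_open U, zariski_dense U
      & forall (L : fieldType) (iota : {rmorphism K -> L})
          (E : 'I_d -> flag L n),
        U L iota E ->
        forall w : 'I_d -> 'S_n,
        \sum_(a < d) perm_length (w a) = 'C(n, 2) ->
        forall F : flag L n,
        (forall a : 'I_d, relative_position (E a) F (w a)) ->
        forall (j : 'I_n.+1) (k : nat) (s : 'I_k.+2 -> 'I_d)
          (x : 'I_d -> 'I_n.+1),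
        1 <= j ->
        (forall p q : 'I_k.+2, p < q -> s p < s q) ->
        (forall p : 'I_k.+2, 1 <= x (s p) <= n - 1) ->
        \dim ((\bigcap_(p < k.+2) E (s p) (x (s p))) :&: F j)%VS =
        maxn
          (\dim (E (s ord0) (x (s ord0)) :&: F j)%VS +
           \dim ((\bigcap_(p < k.+2 | 0 < p) E (s p) (x (s p))) :&: F j)%VS
           - j)
          (\dim ((\bigcap_(p < k.+2) E (s p) (x (s p)))
                 :&: F (inord j.-1))%VS)].
Proof.
exists (@generic_flags K n d); split.
- exact: generic_flags_open.
- exact: generic_flags_dense.
move=> L iota E [M aM [P IP nzP]] w sumw F EF j k s x j_gt0 s_mono _.
have ltj : j.-1 < n by rewrite prednK // -ltnS.
pose j0 := Ordinal ltj.
have -> : inord j.-1 = widen_ord (leqnSn n) j0.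
  by apply/val_inj; rewrite /= inordK // ltnS ltnW.
have ej : j = lift ord0 j0 by apply/val_inj; rewrite /= /bump leq0n add1n prednK.
set Flo := F (widen_ord _ _); set T0 := (\bigcap_(p < k.+2) _)%VS.
set T' := (\bigcap_(p < k.+2 | 0 < p) _ :&: F j)%VS.
set V0 := (E _ _ :&: F j)%VS; set T := (T0 :&: F j)%VS.
have subF : (Flo <= F j)%VS by apply: flag_sub; exact: leq_pred.
have TE : (T = V0 :&: T')%VS.
  rewrite /T /T0 (bigD1 ord0) //= (eq_bigl (fun p : 'I_k.+2 => 0 < p)); last first.
    by move=> p; rewrite lt0n.
  exact: capv_distr.
have dV0 : \dim V0 <= j by rewrite -[X in _ <= X](flag_dim F) dimvS // capvSr.
have lowT : \dim V0 + \dim T' <= \dim T + j.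
  have T'F : (T' <= F j)%VS by exact: capvSr.
  by have := dim_cap_ge (capvSr _ _ : V0 <= F j)%VS T'F; rewrite -TE flag_dim.
apply/eqP; rewrite eqn_leq geq_max leq_subLR [j + _]addnC lowT.
rewrite (dimvS (capvS (subvv T0) subF)) !andbT.
rewrite leq_max; have [Tlo|Tlo] := boolP (T <= Flo)%VS.
  by apply/orP; right; rewrite dimvS // subv_cap capvSl.
apply/orP; left.
(* E a ord_max is the whole space, so that the flags outside s count for nothing *)
pose y a := if a \in codom s then x a else ord_max.
have Esub a : (T <= E a (y a))%VS.
  apply: subv_trans (capvSl _ _) _; rewrite /y; case: ifPn => [/codomP[p ->]|_].
    exact: bigcapv_inf (subvv _).
  by rewrite flag_full subvf.
have bound : \dim T + \sum_a (j - \dim (E a (y a) :&: F j)) <= j.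
  rewrite leqNgt; apply/negP => big; case: nzP.
  have Thi : (T <= F (lift ord0 j0))%VS by rewrite -ej capvSr.
  rewrite ej in big; have [th sth sM] := excess_patterned aM sumw EF Esub Thi Tlo big.
  exact: IP sth _ _ _ sM.
(* the bound for T, against the codimension inequality for the intersection
   without E (s ord0), leaves the codimension of V0 *)
have := @codim_bigcap L _ _ (index_enum 'I_d) (fun a => a != s ord0) (fun a => E a (y a)) (F j).
have : \dim ((\bigcap_(a | a != s ord0) E a (y a)) :&: F j)%VS <= \dim T'.
  apply/dimvS/capvS => //; apply/subv_bigcapP => p p_gt0.
  have sp : s p != s ord0 by rewrite -val_eqE (gtn_eqF (s_mono _ _ _)).
  by apply: (bigcapv_inf (s p)); rewrite // /y codom_f.
move: bound; rewrite (bigD1 (s ord0)) //= {1}/y codom_f -/V0 flag_dim.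
have arith (i t v t' z S : nat) :
  v <= i -> t + (i - v + S) <= i -> z <= t' -> i <= z + S -> t <= v + t' - i by lia.
exact: arith dV0.
Qed.
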